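(* Let $G$ be a nontrivial finite group, identified via an injective homomorphism with a subgroup of the symmetric group $S_k$ for some $k\in\mathbb{N}$, and let $\psi_{AB}=|\psi\rangle\langle\psi|_{AB}$ be a pure bipartite state on $\mathcal{H}_A\otimes\mathcal{H}_B$. Then the generalized bipartite pure-state separability algorithm is a faithful test for separability of $\psi_{AB}$: its acceptance probability $p_G$ equals $1$ if and only if $\psi_{AB}$ is separable, i.e. if and only if $|\psi\rangle_{AB}=|\phi\rangle_A\otimes|\varphi\rangle_B$ for some unit vectors $|\phi\rangle_A\in\mathcal{H}_A$ and $|\varphi\rangle_B\in\mathcal{H}_B$.
   Context: $\mathcal{H}_A,\mathcal{H}_B$ are finite-dimensional complex Hilbert spaces; a pure state is a rank-one projection $|\psi\rangle\langle\psi|$ with $|\psi\rangle$ a unit vector. For $\pi\in S_k$, $W_{B_1\cdots B_k}(\pi)$ is the unitary on $\mathcal{H}_B^{\otimes k}$ permuting the tensor factors: $W_{B_1\cdots B_k}(\pi)(v_1\otimes\cdots\otimes v_k)=v_{\pi^{-1}(1)}\otimes\cdots\otimes v_{\pi^{-1}(k)}$. The generalized algorithm performs a $G$-Bose symmetry test on $\psi_{AB}^{\otimes k}$ with respect to the representation $g\mapsto I_{A_1\cdots A_k}\otimes W_{B_1\cdots B_k}(g)$ of $G\le S_k$; its acceptance probability is $$p_G:=\operatorname{Tr}\Big[\Big(I_{A_1\cdots A_k}\otimes \frac{1}{|G|}\sum_{g\in G}W_{B_1\cdots B_k}(g)\Big)\psi_{AB}^{\otimes k}\Big],$$ where $W_{B_1\cdots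 B_k}(g)$ acts on the $k$ copies of $\mathcal{H}_B$ and $I_{A_1\cdots A_k}$ on the $k$ copies of $\mathcal{H}_A$. *)

(* Defs.v *)
From mathcomp Require Import all_boot all_order all_algebra all_fingroup.
From mathcomp Require Import spectral.
From mathcomp Require Export complex.
From mathcomp Require Import mxtens.
From mathcomp Require Export reals.

Set Implicit Arguments.
Unset Strict Implicit.
Unset Printing Implicit Defensive.

Import GRing.Theory.
Local Open Scope ring_scope.
Local Open Scope sesquilinear_scope.

(* A d-dimensional Hilbert space over C is 'cV[C]_d with its standard inner
   product; H_A (x) H_B is 'cV[C]_(m * n) through the Kronecker product *t. *)

Definition unit_vector (C : numClosedFieldType) d (v : 'cV[C]_d) : Prop :=
  v ^t* *m v = 1%:M.

Definition pure_state (C : numClosedFieldType) d (v : 'cV[C]_d) : 'M[C]_d :=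
  v *m v ^t*.

(* The Kronecker product of two columns has 1 * 1 columns, which is convertible
   to 1; tensv fixes the type. *)
Definition tensv (C : numClosedFieldType) m n (u : 'cV[C]_m) (v : 'cV[C]_n) :
  'cV[C]_(m * n) := u *t v.

Definition separable (C : numClosedFieldType) m n (psi : 'cV[C]_(m * n)) :
  Prop :=
  exists (phi : 'cV[C]_m) (varphi : 'cV[C]_n),
    [/\ unit_vector phi, unit_vector varphi & psi = tensv phi varphi].

(* The standard basis of the k-fold tensor power of 'cV[C]_d is labelled by the
   maps f : 'I_k -> 'I_d, f standing for e_(f 0) (x) ... (x) e_(f (k - 1)). *)
Notation multi_index k d := {ffun 'I_k -> 'I_d}.
Notation tdim k d := #|{: multi_index k d}|.

Definition tens_fam (C : numClosedFieldType) k d (v : 'I_k -> 'cV[C]_d) :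
  'cV[C]_(tdim k d) :=
  \col_x \prod_(l < k) v l ((enum_val x : multi_index k d) l) 0.

Definition tens_pow (C : numClosedFieldType) k d (M : 'M[C]_d) :
  'M[C]_(tdim k d) :=
  \matrix_(x, y) \prod_(l < k)
    M ((enum_val x : multi_index k d) l) ((enum_val y : multi_index k d) l).

(* W maps the basis vector labelled f to the one labelled f \o pi^-1; its
   action on all product vectors is perm_op_tens_fam below.  Products in 'S_k
   compose left to right, so perm_op reverses products; its average over a
   subgroup of 'S_k does not depend on this convention. *)
Definition perm_op (C : numClosedFieldType) k d (pi : 'S_k) :
  'M[C]_(tdim k d) :=
  \matrix_(x, y)
    ((enum_val x : multi_index k d)
       == [ffun l => (enum_val y : multi_index k d) ((pi^-1)%g l)])%:R.

(* The basis vectors of (H_A)^(x)k (x) (H_B)^(x)k and of (H_A (x) H_B)^(x)k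
   correspond through (a, b) |-> (l |-> (a l, b l)); regroup transports an
   operator on the second space to the first one. *)
Definition pair_index k m n (z : 'I_(tdim k m * tdim k n)) :
  'I_(tdim k (m * n)) :=
  enum_rank ([ffun l =>
    mxtens_index ((enum_val (mxtens_unindex z).1 : multi_index k m) l,
                  (enum_val (mxtens_unindex z).2 : multi_index k n) l)]
    : multi_index k (m * n)).

Definition regroup (C : numClosedFieldType) k m n
    (M : 'M[C]_(tdim k (m * n))) : 'M[C]_(tdim k m * tdim k n) :=
  mxsub (@pair_index k m n) (@pair_index k m n) M.

Definition acceptance_prob (C : numClosedFieldType) (gT : finGroupType)
    (G : {group gT}) k (iota : {morphism G >-> 'S_k}) m n
    (rho : 'M[C]_(m * n)) : C :=
  \tr (((1%:M : 'M[C]_(tdim k m))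
          *t (#|G|%:R^-1 *: \sum_(g in G) perm_op C n (iota g)))
       *m regroup (tens_pow k rho)).

Lemma perm_op_tens_fam (C : numClosedFieldType) k d (pi : 'S_k)
    (v : 'I_k -> 'cV[C]_d) :
  perm_op C d pi *m tens_fam v = tens_fam (fun l => v ((pi^-1)%g l)).
Proof.
apply/matrixP=> x j; rewrite !mxE.
pose f : multi_index k d := [ffun l => (enum_val x : multi_index k d) (pi l)].
rewrite (bigD1 (enum_rank f)) //= big1 => [|y ney].
  rewrite !mxE enum_rankK addr0.
  have -> : enum_val x = [ffun l => f ((pi^-1)%g l)].
    by apply/ffunP=> l; rewrite !ffunE permKV.
  rewrite eqxx mul1r (reindex_inj (@perm_inj _ (pi^-1)%g)).
  by apply: eq_bigr => l _; rewrite [in RHS]ffunE.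
rewrite !mxE; case: eqP => [ex|_]; last by rewrite mul0r.
case/eqP: ney; rewrite -[y]enum_valK; congr enum_rank.
by apply/ffunP=> l; rewrite ffunE ex ffunE permK.
Qed.

Lemma pair_index_bij k m n : bijective (@pair_index k m n).
Proof.
apply: inj_card_bij => [z w /enum_rank_inj /ffunP e|]; last first.
  by rewrite !card_ord !card_ffun !card_ord expnMn leqnn.
suff ezw : mxtens_unindex z = mxtens_unindex w.
  by rewrite -[z]mxtens_unindexK ezw mxtens_unindexK.
move: e; case: (mxtens_unindex z) => a b; case: (mxtens_unindex w) => a' b' /= e.
have {}e l : (enum_val a l, enum_val b l) = (enum_val a' l, enum_val b' l).
  by move: (e l); rewrite !ffunE => /(can_inj (@mxtens_indexK m n)).
by congr (_, _); apply: enum_val_inj; apply/ffunP=> l; case: (e l).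
Qed.

Lemma regroup_tens_pow (C : numClosedFieldType) k m n
    (M : 'M[C]_m) (N : 'M[C]_n) :
  regroup (tens_pow k (M *t N)) = tens_pow k M *t tens_pow k N.
Proof.
apply/matrixP=> z w; rewrite !mxE !enum_rankK -big_split /=.
by apply: eq_bigr => l _; rewrite !ffunE tensmxE.
Qed.

Lemma tens_pow_pure_state (C : numClosedFieldType) k d (v : 'cV[C]_d) :
  tens_pow k (pure_state v) = pure_state (tens_fam (fun _ : 'I_k => v)).
Proof.
apply/matrixP=> x y; rewrite !mxE big_ord1 !mxE rmorph_prod -big_split /=.
by apply: eq_bigr => l _; rewrite !mxE big_ord1 !mxE.
Qed.

(* Main.v *)
(* With V = |psi>^(x)k regrouped and U_g = 1 (x) W(g), the acceptance probability
   is the average of <V, U_g V>; it equals 1 iff every U_g fixes V, because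
   |V - U_g V|^2 = 2 - 2 Re <V, U_g V>.  Writing P for the coefficient matrix of
   psi, this says prod_l P(a l, b (g^-1 l)) = prod_l P(a l, b l) for all a, b.
   Product states satisfy it trivially; conversely a single g <> 1 already
   forces P(i, j) P(i0, j0) = P(i, j0) P(i0, j), i.e. rank one. *)
Require Import Defs.
From mathcomp Require Import all_boot all_order all_algebra all_fingroup.
From mathcomp Require Import spectral mxtens.
From mathcomp Require Import ring.

Set Implicit Arguments.
Unset Strict Implicit.
Unset Printing Implicit Defensive.

Import GRing.Theory Num.Theory.
Local Open Scope ring_scope.
Local Open Scope sesquilinear_scope.

(** * Squared norms and averages of isometries *)

Lemma mxtrace_adjmx_mul (C : numClosedFieldType) p (v : 'cV[C]_p) :
  \tr (v ^t* *m v) = \sum_i `|v i 0| ^+ 2.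
Proof.
rewrite /mxtrace big_ord1 mxE; apply: eq_bigr => i _.
by rewrite !mxE normCK mulrC.
Qed.

Lemma mxtrace_adjmx_mul_ge0 (C : numClosedFieldType) p (v : 'cV[C]_p) :
  0 <= \tr (v ^t* *m v).
Proof. by rewrite mxtrace_adjmx_mul sumr_ge0 // => i _; rewrite exprn_ge0. Qed.

Lemma mxtrace_adjmx_mul_eq0 (C : numClosedFieldType) p (v : 'cV[C]_p) :
  \tr (v ^t* *m v) = 0 -> v = 0.
Proof.
rewrite mxtrace_adjmx_mul => /eqP.
rewrite psumr_eq0 => [/allP v0|i _]; last by rewrite exprn_ge0.
apply/colP=> i; rewrite mxE; apply/eqP.
by have := v0 i (mem_index_enum _); rewrite sqrf_eq0 normr_eq0.
Qed.

Lemma unit_vectorP (C : numClosedFieldType) p (v : 'cV[C]_p) :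
  unit_vector v <-> \sum_i `|v i 0| ^+ 2 = 1.
Proof.
rewrite -mxtrace_adjmx_mul; split=> [->|v1]; first by rewrite mxtrace1.
by apply/matrixP=> i j; rewrite !ord1 -trace_mx11 v1 !mxE.
Qed.

Lemma mxtrace_adjmx_mul_conj (C : numClosedFieldType) p (u v : 'cV[C]_p) :
  \tr (u ^t* *m v) = (\tr (v ^t* *m u))^*.
Proof.
rewrite /mxtrace !big_ord1 !mxE rmorph_sum; apply: eq_bigr => i _.
by rewrite !mxE rmorphM /= conjCK mulrC.
Qed.

Lemma mxtrace_average_isometry_eq1 (C : numClosedFieldType) (I : finType)
    (A : {set I}) p (U : I -> 'M[C]_p) (v : 'cV[C]_p) :
    A != set0 -> (forall g, (U g) ^t* *m U g = 1%:M) -> unit_vector v ->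
  \tr ((#|A|%:R^-1 *: \sum_(g in A) U g) *m pure_state v) = 1 <->
  (forall g, g \in A -> U g *m v = v).
Proof.
move=> A0 Uiso v1.
have cA0 : #|A|%:R != 0 :> C by rewrite pnatr_eq0 cards_eq0.
pose t g := \tr (v ^t* *m (U g *m v)).
have -> : \tr ((#|A|%:R^-1 *: \sum_(g in A) U g) *m pure_state v) =
          #|A|%:R^-1 * \sum_(g in A) t g.
  rewrite -scalemxAl mxtraceZ mulmx_suml raddf_sum /=; congr (_ * _).
  by apply: eq_bigr => g _; rewrite mulmxA mxtrace_mulC.
have dist g : \tr ((v - U g *m v) ^t* *m (v - U g *m v)) = 2 - t g - (t g)^*.
  have tC : \tr ((U g *m v) ^t* *m v) = (t g)^*.
    exact: mxtrace_adjmx_mul_conj.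
  have UU : (U g *m v) ^t* *m (U g *m v) = 1%:M.
    by rewrite trmx_mul map_mxM /= mulmxA -(mulmxA _ _ (U g)) Uiso mulmx1.
  rewrite (linearB trmx) /= map_mxB mulmxBl !mulmxBr UU v1 !(raddfB mxtrace).
  by rewrite /= tC -/(t g) mxtrace1 /=; ring.
split=> [p1 g Ag|fix_v]; last first.
  rewrite (eq_bigr (fun=> 1)) => [|g Ag]; last by rewrite /t fix_v // v1 mxtrace1.
  by rewrite sumr_const mulVf.
have sum_t : \sum_(g in A) t g = #|A|%:R.
  by rewrite -[LHS](mulVKf cA0) p1 mulr1.
(* The overlaps sum to the real number [#|A|], so the squared distances sum to
   [2 * #|A| - #|A| - #|A|]; being nonnegative, each of them vanishes. *)
have /eqP : \sum_(g in A) \tr ((v - U g *m v) ^t* *m (v - U g *m v)) = 0.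
  rewrite (eq_bigr _ (fun g _ => dist g)) !sumrB sum_t -(rmorph_sum Num.conj) /= sum_t.
  by rewrite conjC_nat sumr_const; ring.
rewrite psumr_eq0 => [/allP/(_ g (mem_index_enum _))|h _]; last first.
  exact: mxtrace_adjmx_mul_ge0.
by rewrite Ag => /eqP/mxtrace_adjmx_mul_eq0/subr0_eq.
Qed.

(** * Action of [1 (x) W(pi)] on basis labels *)

Lemma injective_fun_mx_mulE (C : numClosedFieldType) p (f : 'I_p -> 'I_p)
    (U : 'M[C]_p) (v : 'cV[C]_p) :
    injective f -> (forall x y, U x y = (x == f y)%:R) ->
  forall y, (U *m v) (f y) 0 = v y 0.
Proof.
move=> f_inj UE y; rewrite mxE (bigD1 y) //= UE eqxx mul1r big1 ?addr0 // => z.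
by rewrite UE inj_eq // eq_sym => /negPf->; rewrite mul0r.
Qed.

(** The columns of [U] are distinct basis vectors, hence orthonormal. *)
Lemma injective_fun_mx_isometry (C : numClosedFieldType) p (f : 'I_p -> 'I_p)
    (U : 'M[C]_p) :
    injective f -> (forall x y, U x y = (x == f y)%:R) ->
  U ^t* *m U = 1%:M.
Proof.
move=> f_inj UE; apply/matrixP=> x y; rewrite !mxE (bigD1 (f x)) //= big1.
  by rewrite !mxE !UE eqxx conjC1 mul1r addr0 inj_eq.
by move=> z /negPf zfx; rewrite !mxE !UE zfx conjC0 mul0r.
Qed.

(** The map of labels [(a, b) |-> (a, b \o pi^-1)] by which [1 (x) W(pi)] permutes the product
    basis. *)
Definition permute_right_index k m n (pi : 'S_k)
    (z : 'I_(tdim k m * tdim k n)) : 'I_(tdim k m * tdim k n) :=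
  mxtens_index ((mxtens_unindex z).1,
    enum_rank ([ffun l =>
      (enum_val (mxtens_unindex z).2 : multi_index k n) ((pi^-1)%g l)]
      : multi_index k n)).

Lemma permute_right_index_inj k m n (pi : 'S_k) :
  injective (@permute_right_index k m n pi).
Proof.
move=> z w; case: (mxtens_indexP z) => a b; case: (mxtens_indexP w) => a' b'.
rewrite /permute_right_index !mxtens_indexK /=.
move=> /(can_inj (@mxtens_indexK _ _)) [-> /enum_rank_inj/ffunP e].
congr (mxtens_index (_, _)); apply: enum_val_inj; apply/ffunP=> l.
by have := e (pi l); rewrite !ffunE permK.
Qed.

Lemma tens1_perm_opE (C : numClosedFieldType) k m n (pi : 'S_k) z w :
  ((1%:M : 'M[C]_(tdim k m)) *t perm_op C n pi) z w =
  (z == permute_right_index pi w)%:R.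
Proof.
case: (mxtens_indexP z) => a b; case: (mxtens_indexP w) => a' b'.
rewrite tensmxE !mxE /permute_right_index !mxtens_indexK /=.
rewrite (can_eq (@mxtens_indexK _ _)) xpair_eqE -natrM mulnb.
by rewrite -(can_eq enum_valK b) enum_rankK.
Qed.

(** * The regrouped tensor power and the acceptance criterion *)

(** The vector [V] of the overview: [k] copies of [psi], with all A factors placed before all B
    factors. *)
Definition regrouped_power (C : numClosedFieldType) k m n
    (psi : 'cV[C]_(m * n)) : 'cV[C]_(tdim k m * tdim k n) :=
  rowsub (@pair_index k m n) (tens_fam (fun _ : 'I_k => psi)).

Lemma regrouped_powerE (C : numClosedFieldType) k m n (psi : 'cV[C]_(m * n))
    (a : multi_index k m) (b : multi_index k n) :
  regrouped_power k psi (mxtens_index (enum_rank a, enum_rank b)) 0 =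
  \prod_(l < k) psi (mxtens_index (a l, b l)) 0.
Proof.
rewrite !mxE; apply: eq_bigr => l _.
by rewrite /pair_index mxtens_indexK !enum_rankK ffunE.
Qed.

Lemma regroup_tens_pow_pure_state (C : numClosedFieldType) k m n
    (psi : 'cV[C]_(m * n)) :
  regroup (tens_pow k (pure_state psi)) = pure_state (regrouped_power k psi).
Proof.
by rewrite tens_pow_pure_state; apply/matrixP=> z w; rewrite !mxE !big_ord1 !mxE.
Qed.

Lemma unit_tens_pow (C : numClosedFieldType) k d (v : 'cV[C]_d) :
  unit_vector v -> unit_vector (tens_fam (fun _ : 'I_k => v)).
Proof.
move/unit_vectorP=> v1; apply/unit_vectorP.
under eq_bigr => x _ do rewrite mxE normr_prod -prodrXl.
rewrite -(big_enum_val (fun f : multi_index k d => \prod_(l < k) `|v (f l) 0| ^+ 2)).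
(* Distributivity turns the sum over multi-indices into a product of [k] factors, each the squared
   norm of [v]. *)
rewrite -(bigA_distr_bigA (fun (_ : 'I_k) j => `|v j 0| ^+ 2)) /=.
by rewrite big1.
Qed.

Lemma unit_regrouped_power (C : numClosedFieldType) k m n
    (psi : 'cV[C]_(m * n)) :
  unit_vector psi -> unit_vector (regrouped_power k psi).
Proof.
move=> /(unit_tens_pow k)/unit_vectorP psi1; apply/unit_vectorP.
(* Regrouping only permutes coordinates, so it preserves the norm. *)
rewrite -[RHS]psi1 (reindex _ (onW_bij _ (@pair_index_bij k m n))).
by apply: eq_bigr => z _; rewrite [in LHS]mxE.
Qed.

Lemma perm_op_regrouped_power (C : numClosedFieldType) k m n (pi : 'S_k)
    (psi : 'cV[C]_(m * n)) :
  (1%:M *t perm_op C n pi) *m regrouped_power k psi = regrouped_power k psi <->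
  forall (a : multi_index k m) (b : multi_index k n),
    \prod_(l < k) psi (mxtens_index (a l, b ((pi^-1)%g l))) 0 =
    \prod_(l < k) psi (mxtens_index (a l, b l)) 0.
Proof.
have UE := injective_fun_mx_mulE (regrouped_power k psi)
  (@permute_right_index_inj k m n pi) (@tens1_perm_opE C k m n pi).
have VE (a : multi_index k m) (b : multi_index k n) :
    regrouped_power k psi
      (permute_right_index pi (mxtens_index (enum_rank a, enum_rank b))) 0 =
    \prod_(l < k) psi (mxtens_index (a l, b ((pi^-1)%g l))) 0.
  rewrite /permute_right_index mxtens_indexK regrouped_powerE /=.
  by apply: eq_bigr => l _; rewrite ffunE enum_rankK.
split=> [fixV a b|fixV].
  by rewrite -VE -fixV UE regrouped_powerE.
apply/colP=> z.
(* Every index is the image of some label under the permutation, so it suffices to compare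
   coordinates at such images, where [UE] applies. *)
have [f' _ /(_ z) <-] := injF_bij (@permute_right_index_inj k m n pi).
case: (mxtens_indexP (f' z)) => x y.
by rewrite UE -[x]enum_valK -[y]enum_valK VE regrouped_powerE.
Qed.

Lemma acceptance_prob_eq1 (C : numClosedFieldType) (gT : finGroupType)
    (G : {group gT}) k (iota : {morphism G >-> 'S_k}) m n
    (psi : 'cV[C]_(m * n)) :
    unit_vector psi ->
  acceptance_prob iota (pure_state psi) = 1 <->
  forall g, g \in G -> forall (a : multi_index k m) (b : multi_index k n),
    \prod_(l < k) psi (mxtens_index (a l, b ((iota g)^-1 l)%g)) 0 =
    \prod_(l < k) psi (mxtens_index (a l, b l)) 0.
Proof.
move=> /(unit_regrouped_power k) V1.
pose U g := (1%:M : 'M[C]_(tdim k m)) *t perm_op C n (iota g).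
have Uiso g : (U g) ^t* *m U g = 1%:M.
  apply: injective_fun_mx_isometry (@permute_right_index_inj k m n (iota g)) _.
  exact: tens1_perm_opE.
have G0 : (G : {set gT}) != set0 by apply/set0Pn; exists 1%g.
rewrite /acceptance_prob regroup_tens_pow_pure_state.
(* By linearity of the tensor product in its right factor, the test operator is itself an average of
   isometries. *)
have -> : 1%:M *t (#|G|%:R^-1 *: \sum_(g in G) perm_op C n (iota g)) =
          #|G|%:R^-1 *: \sum_(g in G) U g.
  apply/matrixP=> z w.
  case: (mxtens_indexP z) => a b; case: (mxtens_indexP w) => a' b'.
  rewrite tensmxE [in RHS]mxE [X in _ * X]mxE !summxE mulrCA mulr_sumr.
  by congr (_ * _); apply: eq_bigr => g _; rewrite tensmxE.
apply: iff_trans (mxtrace_average_isometry_eq1 G0 Uiso V1) _.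
by split=> fixV g Gg; apply/perm_op_regrouped_power; exact: fixV.
Qed.

(** * Rank one from a single nontrivial permutation *)

Lemma prod_two_cond (C : comNzRingType) k (s t : 'I_k) (f : 'I_k -> C) c :
  s != t -> (forall l, l != s -> l != t -> f l = c) ->
  \prod_l f l = f s * f t * c ^+ k.-2.
Proof.
move=> st fc; rewrite (bigD1 s) //= (bigD1 t) 1?eq_sym //= mulrA.
rewrite (eq_bigr (fun=> c)) => [|l /andP[]]; last exact: fc.
rewrite prodr_const; congr (_ * _ ^+ _).
(* The exponent counts the slots outside [{s, t}]. *)
have := cardC (pred2 s t); rewrite card2 st card_ord => /(congr1 (subn^~ 2)).
rewrite addKn subn2 => <-; apply: eq_card => l.
by rewrite !inE negb_or.
Qed.

(* Fill all k slots with (i0, j0) except for row i in slot s and column j in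
   the slot t moved onto s: both sides then differ only in the factors at s, t. *)
Lemma permutation_invariant_rank1 (C : fieldType) (k m n : nat) (sigma : 'S_k)
    (P : 'I_m -> 'I_n -> C) (i0 : 'I_m) (j0 : 'I_n) :
    sigma != 1%g -> P i0 j0 != 0 ->
    (forall (a : multi_index k m) (b : multi_index k n),
       \prod_(l < k) P (a l) (b (sigma l)) = \prod_(l < k) P (a l) (b l)) ->
  forall i j, P i j * P i0 j0 = P i j0 * P i0 j.
Proof.
move=> sigma1 P0 invP i j.
have [s sigma_s] : exists s, sigma s != s.
  by apply/existsP; apply: contraR sigma1 => /existsPn fix_s;
     apply/eqP/permP=> l; rewrite perm1; apply/eqP; have := fix_s l; rewrite negbK.
have := invP [ffun l => if l == s then i else i0]
             [ffun l => if l == sigma s then j else j0].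
have st : s != sigma s by rewrite eq_sym.
rewrite !(@prod_two_cond _ k s (sigma s) _ (P i0 j0)) //.
- rewrite !ffunE !eqxx (inj_eq perm_inj) (negPf sigma_s) (negPf st).
  by move/(mulIf (expf_neq0 _ P0)).
- by move=> l /negPf ls /negPf lt; rewrite !ffunE ls lt.
- by move=> l /negPf ls _; rewrite !ffunE (inj_eq perm_inj) ls.
Qed.

Lemma tensvE (C : numClosedFieldType) m n (u : 'cV[C]_m) (v : 'cV[C]_n) i j :
  tensv u v (mxtens_index (i, j)) 0 = u i 0 * v j 0.
Proof. by rewrite !mxE mxtens_indexK /= !ord1. Qed.

(** The squared norms [p] and [q] of the factors have product 1, so moving the scalar [sqrtC p], the
    norm of [phi], from [phi] to [varphi] normalizes both and keeps their tensor product. *)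
Lemma unit_tensv_separable (C : numClosedFieldType) m n (psi : 'cV[C]_(m * n))
    (phi : 'cV[C]_m) (varphi : 'cV[C]_n) :
  unit_vector psi -> psi = tensv phi varphi -> separable psi.
Proof.
move=> /unit_vectorP psi1 psiE.
pose p := \sum_i `|phi i 0| ^+ 2; pose q := \sum_j `|varphi j 0| ^+ 2.
have pq : p * q = 1.
  rewrite -psi1 psiE (reindex (@mxtens_index m n)) /=; last first.
    by exists (@mxtens_unindex m n) => x _; rewrite (mxtens_indexK, mxtens_unindexK).
  rewrite (eq_bigr (fun x => `|phi x.1 0| ^+ 2 * `|varphi x.2 0| ^+ 2)).
    by rewrite /p /q big_distrlr /= pair_bigA.
  by case=> i j _; rewrite tensvE normrM exprMn.
have p0 : p != 0 by apply: contra_eq_neq pq => ->; rewrite mul0r eq_sym oner_eq0.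
have p_ge0 : 0 <= p by rewrite sumr_ge0 // => i _; rewrite exprn_ge0.
have r_neq0 : sqrtC p != 0 by rewrite sqrtC_eq0.
have r2 : `|sqrtC p| ^+ 2 = p by rewrite ger0_norm ?sqrtC_ge0 // sqrtCK.
exists ((sqrtC p)^-1 *: phi), (sqrtC p *: varphi); split.
- apply/unit_vectorP; under eq_bigr => i _ do rewrite mxE normrM normfV exprMn exprVn r2.
  by rewrite -mulr_sumr mulVf.
- apply/unit_vectorP; under eq_bigr => j _ do rewrite mxE normrM exprMn r2.
  by rewrite -mulr_sumr.
- rewrite psiE; apply/matrixP=> x y; rewrite !mxE.
  by rewrite mulrACA mulVf // mul1r.
Qed.

Theorem proposition4p9 (R : realType) (m n k : nat)
    (gT : finGroupType) (G : {group gT}) (G_nontrivial : G :!=: 1%g)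
    (iota : {morphism G >-> 'S_k}) (iota_inj : ('injm iota)%g)
    (psi : 'cV[R[i]]_(m * n)) (psi_unit : unit_vector psi) :
  acceptance_prob iota (pure_state psi) = 1 <-> separable psi.
Proof.
apply: iff_trans (acceptance_prob_eq1 iota psi_unit) _; split=> [inv|]; last first.
  move=> [phi [varphi [_ _ ->]]] g _ a b.
  under eq_bigr do rewrite tensvE.
  under [RHS]eq_bigr do rewrite tensvE.
  (* For a product state the A part does not involve the permutation, and the B part is a reindexed
     product. *)
  rewrite !big_split /=; congr (_ * _).
  by rewrite [RHS](reindex_inj (@perm_inj _ (iota g)^-1%g)).
have [g Gg g1] := trivgPn _ G_nontrivial.
have sigma1 : ((iota g)^-1 != 1)%g.
  by rewrite invg_eq1 (morph_injm_eq1 iota_inj).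
(* A unit vector has a nonzero coordinate; it serves as the pivot [(i0, j0)]. *)
have [z psi_z] : exists z, psi z 0 != 0.
  apply/existsP; apply: contraT => /existsPn psi0.
  have /unit_vectorP/eqP := psi_unit; rewrite big1 ?[0 == 1]eq_sym ?oner_eq0 //.
  by move=> z _; have := psi0 z; rewrite negbK => /eqP->; rewrite normr0 expr0n.
case: (mxtens_indexP z) psi_z => i0 j0 P0.
have rank1 := permutation_invariant_rank1 (P := fun i j => psi (mxtens_index (i, j)) 0)
  sigma1 P0 (inv g Gg).
(* Column [j0] divided by the pivot, and row [i0], factor the rank-one coefficient matrix; they need
   not be unit vectors yet. *)
apply: (unit_tensv_separable (phi := \col_i (psi (mxtens_index (i, j0)) 0
                                      / psi (mxtens_index (i0, j0)) 0))
  (varphi := \col_j psi (mxtens_index (i0, j)) 0) psi_unit).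
apply/colP=> w; case: (mxtens_indexP w) => i j.
by rewrite tensvE !mxE mulrAC -rank1 mulfK.
Qed.
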